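(* Let $\hbar\in\mathbb{C}\setminus\{0\}$, $h=2i\hbar$, and let $\mathcal{A}=\big(U(su(2)_h)\otimes\mathbb{C}[t,r_\hbar]\big)/\langle x^2+y^2+z^2+\hbar^2-r_\hbar^2\rangle$. The assignment $$\hat\Theta(1)=I,\quad \hat\Theta(t)=(t+i\hbar)I,\quad \hat\Theta(x)=xI+i\hbar A,\quad \hat\Theta(y)=yI+i\hbar B,\quad \hat\Theta(z)=zI+i\hbar C,$$ $$\hat\Theta(r_\hbar)=\frac{r_\hbar^2+\hbar^2}{r_\hbar}\,I+\frac{i\hbar}{r_\hbar}\,M,\qquad M=xA+yB+zC,$$ extended multiplicatively and linearly, sends the element $x^2+y^2+z^2+\hbar^2-r_\hbar^2$ to $0$ and gives a well-defined unital algebra homomorphism $\hat\Theta:\mathcal{A}\to\mathrm{Mat}_4(\mathcal{A}[r_\hbar^{-1}])$. The corresponding quantum partial derivatives act on the quantum radius $r_\hbar$ by $$\partial_t r_\hbar=-\frac{i\hbar}{r_\hbar},\qquad \partial_xr_\hbar=\frac{x}{r_\hbar},\qquad \partial_yr_\hbar=\frac{y}{r_\hbar},\qquad \partial_zr_\hbar=\frac{z}{r_\hbar}.$$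
   Context: $U(su(2)_h)$ is the unital associative $\mathbb{C}$-algebra generated by $x,y,z$ with relations $[x,y]=hz$, $[y,z]=hx$, $[z,x]=hy$. In $\mathcal{A}$ the elements $t$ and $r_\hbar$ (the quantum radius) are central, and $\mathcal{A}[r_\hbar^{-1}]$ is the localization inverting the central element $r_\hbar$. $I$ is the $4\times4$ identity matrix and $$A=\begin{pmatrix}0&1&0&0\\-1&0&0&0\\0&0&0&-1\\0&0&1&0\end{pmatrix},\quad B=\begin{pmatrix}0&0&1&0\\0&0&0&1\\-1&0&0&0\\0&-1&0&0\end{pmatrix},\quad C=\begin{pmatrix}0&0&0&1\\0&0&-1&0\\0&1&0&0\\-1&0&0&0\end{pmatrix}.$$ The quantum partial derivatives $\partial_t,\partial_x,\partial_y,\partial_z$ of an element $a$ are read off from the matrix $\hat\Theta(a)$ by $$\hat\Theta(a)=i\hbar\big((\hat\partial_ta)\,I+(\partial_xa)\,A+(\partial_ya)\,B+(\partial_za)\,C\big),\qquad \hat\partial_t=\partial_t+\frac{2}{h}\,\mathrm{id}.$$ *)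

(* Defs.v *)
From HB Require Import structures.
From mathcomp Require Import all_boot all_order all_algebra.
From mathcomp Require Import generic_quotient ring_quotient.
From mathcomp Require Import finmap boolp reals.
From mathcomp Require Import complex.
From mathcomp.multinomials Require Import monalg.

Set Implicit Arguments.
Unset Strict Implicit.
Unset Printing Implicit Defensive.

Import GRing.Theory Num.Theory Num.Def.

Local Open Scope quotient_scope.
Local Open Scope ring_scope.

(* Quotients of a unital associative algebra by finitely many relators. *)

Section TwoSidedIdeal.
Variables (K : comNzRingType) (A : algType K).

Inductive two_sided_ideal (S : seq A) : A -> Prop :=
| Two_sided0 : two_sided_ideal S 0
| Two_sidedD a s b u : s \in S -> two_sided_ideal S u ->
    two_sided_ideal S (a * s * b + u).

(* The library's algebras are nontrivial, so that relators have to be bundled  *)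
(* with a proof that the quotient is not the zero ring.                        *)
Record relators := Relators {
  relators_seq :> seq A;
  relators_proper : ~ two_sided_ideal relators_seq 1 }.

Lemma two_sided_gen (S : seq A) s : s \in S -> two_sided_ideal S s.
Proof.
by move=> Ss; rewrite -[s]addr0 -[s]mulr1 -[s]mul1r; apply: Two_sidedD (Two_sided0 _).
Qed.

Lemma two_sidedD (S : seq A) u v :
  two_sided_ideal S u -> two_sided_ideal S v -> two_sided_ideal S (u + v).
Proof.
move=> Su Sv; elim: Su => [|a s b w Ss _ IH]; first by rewrite add0r.
by rewrite -addrA; apply: Two_sidedD.
Qed.

Lemma two_sidedMl (S : seq A) c u :
  two_sided_ideal S u -> two_sided_ideal S (c * u).
Proof.
elim=> [|a s b w Ss _ IH]; first by rewrite mulr0; apply: Two_sided0.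
by rewrite mulrDr !mulrA; apply: Two_sidedD.
Qed.

Lemma two_sidedMr (S : seq A) c u :
  two_sided_ideal S u -> two_sided_ideal S (u * c).
Proof.
elim=> [|a s b w Ss _ IH]; first by rewrite mul0r; apply: Two_sided0.
by rewrite mulrDl -[a * s * b * c]mulrA; apply: Two_sidedD.
Qed.

Lemma two_sided_kernel (B : zmodType) (f : {additive A -> B}) (S : seq A) :
  (forall a s b, s \in S -> f (a * s * b) = 0) ->
  forall u, two_sided_ideal S u -> f u = 0.
Proof.
move=> fS u; elim=> [|a s b w Ss _ IH]; first by rewrite raddf0.
by rewrite raddfD fS // IH addr0.
Qed.

Definition ideal_pred (S : relators) : {pred A} :=
  fun a => `[< two_sided_ideal S a >].

Lemma ideal_predP (S : relators) a :
  reflect (two_sided_ideal S a) (a \in ideal_pred S).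
Proof. by rewrite unfold_in; apply: asboolP. Qed.

Lemma ideal_zmod_closed (S : relators) : zmod_closed (ideal_pred S).
Proof.
split=> [|u v /ideal_predP Su /ideal_predP Sv]; apply/ideal_predP.
  exact: Two_sided0.
by apply: two_sidedD => //; rewrite -mulN1r; apply: two_sidedMl.
Qed.

HB.instance Definition _ (S : relators) :=
  GRing.isZmodClosed.Build A (ideal_pred S) (ideal_zmod_closed S).

Definition quot_alg (S : relators) : Type := Quotient.quot (ideal_pred S).

End TwoSidedIdeal.

(* Operations and constructors below are locked: unification would otherwise   *)
(* unfold iterated quotients and polynomial rings down to the free algebra.    *)
Fact quot_key : unit. Proof. by []. Qed.

Section QuotientAlgebra.
Variables (K : comNzRingType) (A : algType K) (S : relators A).
Local Notation Q := (quot_alg S).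

HB.instance Definition _ := Choice.on Q.
HB.instance Definition _ := GRing.Zmodule.on Q.

Definition quot_proj : A -> Q :=
  locked_with quot_key (fun a => \pi_(Quotient.quot (ideal_pred S)) a).

Lemma quot_projE a : quot_proj a = \pi_(Quotient.quot (ideal_pred S)) a.
Proof. by rewrite /quot_proj unlock. Qed.

Definition quot_repr (u : Q) : A := repr (u : Quotient.quot (ideal_pred S)).

Lemma quot_reprK u : quot_proj (quot_repr u) = u.
Proof. by rewrite quot_projE; apply: reprK. Qed.

Lemma quot_projP a b : quot_proj a = quot_proj b <-> two_sided_ideal S (a - b).
Proof.
rewrite !quot_projE; split=> [/eqP | Sab].
  by rewrite -Quotient.idealrBE => /ideal_predP.
by apply/eqP; rewrite -Quotient.idealrBE; apply/ideal_predP.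
Qed.

Lemma quot_reprP a : two_sided_ideal S (quot_repr (quot_proj a) - a).
Proof. by apply/quot_projP; rewrite quot_reprK. Qed.

Lemma quot_ind (P : Q -> Prop) : (forall a, P (quot_proj a)) -> forall u, P u.
Proof. by move=> PQ u; rewrite -[u]quot_reprK. Qed.

Fact quot_proj_zmod : zmod_morphism quot_proj.
Proof.
by move=> a b; rewrite !quot_projE (raddfB \pi_(Quotient.quot (ideal_pred S))).
Qed.

HB.instance Definition _ :=
  GRing.isZmodMorphism.Build A Q quot_proj quot_proj_zmod.

Definition quot_one : Q := quot_proj 1.
Definition quot_mul : Q -> Q -> Q :=
  locked_with quot_key (fun u v => quot_proj (quot_repr u * quot_repr v)).
Definition quot_scale : K -> Q -> Q :=
  locked_with quot_key (fun k u => quot_proj (k *: quot_repr u)).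

Lemma quot_mulE a b : quot_mul (quot_proj a) (quot_proj b) = quot_proj (a * b).
Proof.
rewrite /quot_mul unlock; apply/quot_projP.
set a' := quot_repr _; set b' := quot_repr _.
have -> : a' * b' - a * b = (a' - a) * b' + a * (b' - b).
  by rewrite mulrBl mulrBr addrA subrK.
by apply: two_sidedD; [apply: two_sidedMr|apply: two_sidedMl]; apply: quot_reprP.
Qed.

Lemma quot_scaleE k a : quot_scale k (quot_proj a) = quot_proj (k *: a).
Proof.
rewrite /quot_scale unlock; apply/quot_projP; rewrite -scalerBr -[_ - _]mul1r scalerAl.
by apply: two_sidedMl; apply: quot_reprP.
Qed.

Fact quot_mulA : associative quot_mul.
Proof.
by elim/quot_ind=> a; elim/quot_ind=> b; elim/quot_ind=> c; rewrite !quot_mulE mulrA.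
Qed.

Fact quot_mul1 : left_id quot_one quot_mul.
Proof. by elim/quot_ind=> a; rewrite quot_mulE mul1r. Qed.

Fact quot_mulr1 : right_id quot_one quot_mul.
Proof. by elim/quot_ind=> a; rewrite quot_mulE mulr1. Qed.

Fact quot_mulDl : left_distributive quot_mul +%R.
Proof.
elim/quot_ind=> a; elim/quot_ind=> b; elim/quot_ind=> c.
by rewrite -raddfD !quot_mulE -raddfD mulrDl.
Qed.

Fact quot_mulDr : right_distributive quot_mul +%R.
Proof.
elim/quot_ind=> a; elim/quot_ind=> b; elim/quot_ind=> c.
by rewrite -raddfD !quot_mulE -raddfD mulrDr.
Qed.

Fact quot_one_neq0 : quot_one != 0.
Proof.
apply/eqP; rewrite -(raddf0 quot_proj) => /quot_projP; rewrite subr0.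
exact: relators_proper.
Qed.

HB.instance Definition _ := GRing.Zmodule_isNzRing.Build Q
  quot_mulA quot_mul1 quot_mulr1 quot_mulDl quot_mulDr quot_one_neq0.

Fact quot_proj_monoid : monoid_morphism quot_proj.
Proof. by split=> // a b; rewrite -quot_mulE. Qed.

HB.instance Definition _ :=
  GRing.isMonoidMorphism.Build A Q quot_proj quot_proj_monoid.

Fact quot_scaleA a b (v : Q) :
  quot_scale a (quot_scale b v) = quot_scale (a * b) v.
Proof. by elim/quot_ind: v => v; rewrite !quot_scaleE scalerA. Qed.

Fact quot_scale1 : left_id 1 quot_scale.
Proof. by elim/quot_ind=> a; rewrite quot_scaleE scale1r. Qed.

Fact quot_scaleDr : right_distributive quot_scale +%R.
Proof.
move=> k; elim/quot_ind=> a; elim/quot_ind=> b.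
by rewrite -raddfD !quot_scaleE -raddfD scalerDr.
Qed.

Fact quot_scaleDl (v : Q) : {morph quot_scale^~ v : a b / a + b}.
Proof. by elim/quot_ind: v => v a b; rewrite !quot_scaleE -raddfD scalerDl. Qed.

HB.instance Definition _ := GRing.Zmodule_isLmodule.Build K Q
  quot_scaleA quot_scale1 quot_scaleDr quot_scaleDl.

Fact quot_proj_scalable : scalable quot_proj.
Proof. by move=> k a; rewrite -quot_scaleE. Qed.

HB.instance Definition _ :=
  GRing.isScalable.Build K A Q *:%R quot_proj quot_proj_scalable.

Fact quot_scaleAl k (u v : Q) : k *: (u * v) = (k *: u) * v.
Proof.
elim/quot_ind: u => a; elim/quot_ind: v => b.
by rewrite -rmorphM -!linearZ -rmorphM scalerAl.
Qed.

HB.instance Definition _ := GRing.Lmodule_isLalgebra.Build K Q quot_scaleAl.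

Fact quot_scaleAr k (u v : Q) : k *: (u * v) = u * (k *: v).
Proof.
elim/quot_ind: u => a; elim/quot_ind: v => b.
by rewrite -rmorphM -!linearZ -rmorphM scalerAr.
Qed.

HB.instance Definition _ := GRing.Lalgebra_isAlgebra.Build K Q quot_scaleAr.

End QuotientAlgebra.

Arguments quot_proj {K A} S a.

Section QuotientLift.
Variables (K : comNzRingType) (A : algType K) (S : relators A).
Variables (B : nzRingType) (f : {rmorphism A -> B}).

Definition quot_lift (f0 : forall s, s \in relators_seq S -> f s = 0)
  (u : quot_alg S) : B := f (quot_repr u).

Hypothesis f0 : forall s, s \in relators_seq S -> f s = 0.
Local Notation g := (quot_lift f0).

Lemma quot_liftE a : g (quot_proj S a) = f a.
Proof.
apply/eqP; rewrite -subr_eq0 -rmorphB; apply/eqP.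
apply: two_sided_kernel (quot_reprP S a) => b s c Ss.
by rewrite /= !rmorphM (f0 Ss) mulr0 mul0r.
Qed.

Fact quot_lift_zmod : zmod_morphism g.
Proof.
elim/quot_ind=> a; elim/quot_ind=> b.
by rewrite -raddfB !quot_liftE rmorphB.
Qed.

Fact quot_lift_monoid : monoid_morphism g.
Proof.
split; first by rewrite -(rmorph1 (quot_proj S)) quot_liftE rmorph1.
elim/quot_ind=> a; elim/quot_ind=> b.
by rewrite -rmorphM !quot_liftE rmorphM.
Qed.

HB.instance Definition _ :=
  GRing.isZmodMorphism.Build (quot_alg S) B g quot_lift_zmod.
HB.instance Definition _ :=
  GRing.isMonoidMorphism.Build (quot_alg S) B g quot_lift_monoid.

End QuotientLift.

Lemma proper_rmorph (K : comNzRingType) (A : algType K) (B : nzRingType)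
    (f : {rmorphism A -> B}) (S : seq A) :
  (forall s, s \in S -> f s = 0) -> ~ two_sided_ideal S 1.
Proof.
move=> f0 S1; have /eqP := oner_neq0 B; apply; rewrite -(rmorph1 f).
apply: two_sided_kernel S1 => a s b Ss.
by rewrite /= !rmorphM (f0 _ Ss) mulr0 mul0r.
Qed.

(* The free associative algebra K<I>. *)

Fact free_alg_key : unit. Proof. by []. Qed.

Section FreeAlgebra.
Variables (K : comNzRingType) (I : choiceType).

Definition free_alg : Type := {malg K[{fmonom I}]}.

HB.instance Definition _ := GRing.Zmodule.on free_alg.

Definition free_one : free_alg := (1 : {malg K[{fmonom I}]}).
Definition free_mul : free_alg -> free_alg -> free_alg :=
  locked_with free_alg_key (fun u v : {malg K[{fmonom I}]} => u * v).

Lemma free_mulE (u v : {malg K[{fmonom I}]}) : free_mul u v = u * v.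
Proof. by rewrite /free_mul unlock. Qed.

Fact free_mulA : associative free_mul.
Proof. by move=> u v w; rewrite !free_mulE mulrA. Qed.

Fact free_mul1 : left_id free_one free_mul.
Proof. by move=> u; rewrite free_mulE mul1r. Qed.

Fact free_mulr1 : right_id free_one free_mul.
Proof. by move=> u; rewrite free_mulE mulr1. Qed.

Fact free_mulDl : left_distributive free_mul +%R.
Proof. by move=> u v w; rewrite !free_mulE mulrDl. Qed.

Fact free_mulDr : right_distributive free_mul +%R.
Proof. by move=> u v w; rewrite !free_mulE mulrDr. Qed.

Fact free_one_neq0 : free_one != 0.
Proof. exact: oner_neq0. Qed.

HB.instance Definition _ := GRing.Zmodule_isNzRing.Build free_alg
  free_mulA free_mul1 free_mulr1 free_mulDl free_mulDr free_one_neq0.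

Definition free_scale : K -> free_alg -> free_alg :=
  locked_with free_alg_key (fun k (u : {malg K[{fmonom I}]}) => k *: u).

Lemma free_scaleE k (u : {malg K[{fmonom I}]}) : free_scale k u = k *: u.
Proof. by rewrite /free_scale unlock. Qed.

Fact free_scaleA a b v : free_scale a (free_scale b v) = free_scale (a * b) v.
Proof. by rewrite !free_scaleE scalerA. Qed.

Fact free_scale1 : left_id 1 free_scale.
Proof. by move=> v; rewrite free_scaleE scale1r. Qed.

Fact free_scaleDr : right_distributive free_scale +%R.
Proof. by move=> k u v; rewrite !free_scaleE scalerDr. Qed.

Fact free_scaleDl v : {morph free_scale^~ v : a b / a + b}.
Proof. by move=> a b; rewrite !free_scaleE scalerDl. Qed.

HB.instance Definition _ := GRing.Zmodule_isLmodule.Build K free_alg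
  free_scaleA free_scale1 free_scaleDr free_scaleDl.

Fact free_scaleAl k (u v : free_alg) : k *: (u * v) = (k *: u) * v.
Proof.
rewrite -[LHS]/(free_scale k (free_mul u v)) -[RHS]/(free_mul (free_scale k u) v).
by rewrite !(free_mulE, free_scaleE) scalerAl.
Qed.

HB.instance Definition _ :=
  GRing.Lmodule_isLalgebra.Build K free_alg free_scaleAl.

Fact free_alg_scaleAr k (u v : free_alg) : k *: (u * v) = u * (k *: v).
Proof.
rewrite -[LHS]/(free_scale k (free_mul u v)) -[RHS]/(free_mul u (free_scale k v)).
rewrite !(free_mulE, free_scaleE).
apply/malgP=> m; rewrite mcoeffZ [in LHS]mcoeffMl.
rewrite (mcoeffMlw m (fsubset_refl _) (msuppZ_le k v)) mulr_sumr.
apply: eq_bigr => m1 _; rewrite mulr_sumr; apply: eq_bigr => m2 _.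
by rewrite mcoeffZ mulrCA mulrnAr.
Qed.

HB.instance Definition _ :=
  GRing.Lalgebra_isAlgebra.Build K free_alg free_alg_scaleAr.

Definition free_gen : I -> free_alg :=
  locked_with free_alg_key (fun i => << fmu i >>%R : {malg K[{fmonom I}]}).

Section Character.
Variable v : I -> K.

Definition monom_eval (m : {fmonom I}) : K := \prod_(i <- m) v i.

Fact monom_eval_mmorphism : mmorphism monom_eval.
Proof.
split=> [m1 m2|]; rewrite /monom_eval; first by rewrite fmM big_cat.
by rewrite fm1 big_nil.
Qed.

HB.instance Definition _ :=
  isMultiplicative.Build {fmonom I} K monom_eval monom_eval_mmorphism.

Definition free_eval : free_alg -> K := mmap idfun monom_eval.

Fact free_eval_zmod : zmod_morphism free_eval.
Proof. exact: (@rmorphB {malg K[{fmonom I}]} K (mmap idfun monom_eval)). Qed.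

Fact free_eval_monoid : monoid_morphism free_eval.
Proof.
split; first exact: (rmorph1 (mmap idfun monom_eval)).
move=> u v'; rewrite -[u * v']/(free_mul u v') free_mulE.
exact: (rmorphM (mmap idfun monom_eval)).
Qed.

HB.instance Definition _ :=
  GRing.isZmodMorphism.Build free_alg K free_eval free_eval_zmod.
HB.instance Definition _ :=
  GRing.isMonoidMorphism.Build free_alg K free_eval free_eval_monoid.

Lemma free_evalZ k u : free_eval (k *: u) = k * free_eval u.
Proof. by rewrite -[k *: u]/(free_scale k u) free_scaleE; apply: mmapZ. Qed.

Lemma free_evalU i : free_eval (free_gen i) = v i.
Proof. by rewrite /free_gen unlock /free_eval mmapU mul1r /monom_eval fmU big_seq1. Qed.

End Character.

End FreeAlgebra.

(* A (x) K[X]: polynomials in a central indeterminate over A, as a K-algebra.  *)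
(* The library only equips {poly A} with its A-module structure.               *)

Fact cp_key : unit. Proof. by []. Qed.

Section CentralPoly.
Variables (K : comNzRingType) (A : algType K).

Definition central_poly : Type := {poly A}.

HB.instance Definition _ := GRing.NzRing.on central_poly.

Definition cp_var : central_poly := locked_with cp_key ('X : {poly A}).
Definition cp_const : A -> central_poly :=
  locked_with cp_key (fun a => a%:P : {poly A}).

Lemma cp_varE : cp_var = 'X.
Proof. by rewrite /cp_var unlock. Qed.

Lemma cp_constE a : cp_const a = a%:P.
Proof. by rewrite /cp_const unlock. Qed.

Fact cp_const_zmod : zmod_morphism cp_const.
Proof. by move=> a b; rewrite !cp_constE polyCB. Qed.

Fact cp_const_monoid : monoid_morphism cp_const.
Proof. by split=> [|a b]; rewrite !cp_constE ?polyCM. Qed.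

HB.instance Definition _ :=
  GRing.isZmodMorphism.Build A central_poly cp_const cp_const_zmod.
HB.instance Definition _ :=
  GRing.isMonoidMorphism.Build A central_poly cp_const cp_const_monoid.

Definition cp_scale : K -> central_poly -> central_poly :=
  locked_with cp_key (fun k p => cp_const k%:A * p).

Lemma cp_scaleE k p : cp_scale k p = cp_const k%:A * p.
Proof. by rewrite /cp_scale unlock. Qed.

Fact cp_scaleA a b v : cp_scale a (cp_scale b v) = cp_scale (a * b) v.
Proof. by rewrite !cp_scaleE mulrA -rmorphM -scalerAl mul1r scalerA. Qed.

Fact cp_scale1 : left_id 1 cp_scale.
Proof. by move=> v; rewrite cp_scaleE scale1r rmorph1 mul1r. Qed.

Fact cp_scaleDr : right_distributive cp_scale +%R.
Proof. by move=> k u v; rewrite !cp_scaleE mulrDr. Qed.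

Fact cp_scaleDl v : {morph cp_scale^~ v : a b / a + b}.
Proof. by move=> a b; rewrite !cp_scaleE scalerDl rmorphD mulrDl. Qed.

HB.instance Definition _ := GRing.Zmodule_isLmodule.Build K central_poly
  cp_scaleA cp_scale1 cp_scaleDr cp_scaleDl.

Fact cp_scaleAl k (u v : central_poly) : k *: (u * v) = (k *: u) * v.
Proof. by rewrite -![k *: _]/(cp_scale k _) !cp_scaleE mulrA. Qed.

HB.instance Definition _ :=
  GRing.Lmodule_isLalgebra.Build K central_poly cp_scaleAl.

Fact cp_scaleAr k (u v : central_poly) : k *: (u * v) = u * (k *: v).
Proof.
rewrite -![k *: _]/(cp_scale k _) !cp_scaleE !mulrA; congr (_ * v).
rewrite cp_constE; apply/polyP=> i; rewrite coefCM coefMC.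
by rewrite -scalerAl -scalerAr mul1r mulr1.
Qed.

HB.instance Definition _ :=
  GRing.Lalgebra_isAlgebra.Build K central_poly cp_scaleAr.

Fact cp_const_scalable : scalable cp_const.
Proof.
by move=> k a; rewrite -[RHS]/(cp_scale k _) cp_scaleE -rmorphM -scalerAl mul1r.
Qed.

HB.instance Definition _ :=
  GRing.isScalable.Build K A central_poly *:%R cp_const cp_const_scalable.

Section Eval.
Variables (B : comNzRingType) (f : {rmorphism A -> B}) (b : B).

Definition cp_eval (p : central_poly) : B := (map_poly f p).[b].

HB.instance Definition _ := GRing.RMorphism.copy cp_eval
  (horner_eval b \o map_poly f : {poly A} -> B).

Lemma cp_evalC a : cp_eval (cp_const a) = f a.
Proof. by rewrite /cp_eval cp_constE map_polyC hornerC. Qed.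

Lemma cp_evalX : cp_eval cp_var = b.
Proof. by rewrite /cp_eval cp_varE map_polyX hornerX. Qed.
End Eval.

End CentralPoly.

Arguments cp_var {K A}.
Arguments cp_const {K A} a.

(* U(su(2)_h) and U(su(2)_h) (x) K[t, r] = U(su(2)_h)[t][r]. *)

Section SU2.
Variables (K : fieldType) (h : K).

Definition su2_relators_seq : seq (free_alg K 'I_3) :=
  let x := free_gen K (0 : 'I_3) in
  let y := free_gen K (1 : 'I_3) in
  let z := free_gen K (2%:R : 'I_3) in
  [:: x * y - y * x - h *: z;
      y * z - z * y - h *: x;
      z * x - x * z - h *: y].

(* This point is only used to see that the quotients below are not zero: x may *)
(* be sent to 1 in the commutative case h = 0, and to 0 otherwise.             *)
Definition su2_point (i : 'I_3) : K := ((i == 0) && (h == 0))%:R.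

Lemma su2_pointP s : s \in su2_relators_seq -> free_eval su2_point s = 0.
Proof.
have E (a b c : 'I_3) : h * su2_point c = 0 ->
    free_eval su2_point (free_gen K a * free_gen K b - free_gen K b * free_gen K a
      - h *: free_gen K c) = 0.
  move=> hc; rewrite !rmorphB !rmorphM /= free_evalZ !free_evalU.
  by rewrite [_ * su2_point a]mulrC subrr hc subr0.
have hx c : h * su2_point c = 0.
  rewrite /su2_point; case: eqP => /= _; last by rewrite mulr0.
  by case: eqP => [->|_]; rewrite ?mul0r ?mulr0.
by rewrite !inE => /or3P[] /eqP ->; apply: E.
Qed.

Fact su2_proper : ~ two_sided_ideal su2_relators_seq 1.
Proof.
exact: (@proper_rmorph K (free_alg K 'I_3) K (free_eval su2_point)) su2_pointP.
Qed.

Definition su2_relators : relators (free_alg K 'I_3) := Relators su2_proper.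

Definition Usu2 : algType K := quot_alg su2_relators.

Definition su2_x : Usu2 := quot_proj su2_relators (free_gen K (0 : 'I_3)).
Definition su2_y : Usu2 := quot_proj su2_relators (free_gen K (1 : 'I_3)).
Definition su2_z : Usu2 := quot_proj su2_relators (free_gen K (2%:R : 'I_3)).

Definition su2_char : Usu2 -> K :=
  @quot_lift K (free_alg K 'I_3) su2_relators K (free_eval su2_point) su2_pointP.

HB.instance Definition _ := GRing.RMorphism.on su2_char.

Lemma su2_charE i :
  su2_char (quot_proj su2_relators (free_gen K i)) = su2_point i.
Proof. by rewrite /su2_char quot_liftE /= free_evalU. Qed.

Lemma su2_charA k : su2_char k%:A = k.
Proof.
rewrite -(rmorph1 (quot_proj su2_relators)) -linearZ /su2_char quot_liftE /=.
by rewrite free_evalZ rmorph1 mulr1.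
Qed.

Definition Utr : algType K := central_poly (central_poly Usu2).

Definition Utr_emb (u : Usu2) : Utr := cp_const (cp_const u).
Definition Utr_x : Utr := Utr_emb su2_x.
Definition Utr_y : Utr := Utr_emb su2_y.
Definition Utr_z : Utr := Utr_emb su2_z.
Definition Utr_t : Utr := cp_const cp_var.
Definition Utr_r : Utr := cp_var.

End SU2.

(* A and A[r_hbar^-1]; 'i is the imaginary unit of K, which is the field of    *)
(* complex numbers in the application.                                         *)

Section QuantumAlgebra.
Variables (K : numClosedFieldType) (hbar : K).

Definition h_of : K := 2 * 'i * hbar.
Local Notation h := h_of.
Local Notation ih := ('i * hbar).

Definition radius_relator : Utr h :=
  Utr_x h ^+ 2 + Utr_y h ^+ 2 + Utr_z h ^+ 2 + (hbar ^+ 2)%:A - Utr_r h ^+ 2.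

(* The value of r_hbar at the point extending su2_point.                       *)
Definition radius_point : K := if hbar == 0 then 1 else hbar.

Definition Utr_char : Utr h -> K := cp_eval (cp_eval (@su2_char K h) 0) radius_point.

HB.instance Definition _ := GRing.RMorphism.on Utr_char.

Lemma Utr_charA k : Utr_char k%:A = k.
Proof.
rewrite -(rmorph1 cp_const) -linearZ /Utr_char cp_evalC /=.
by rewrite -(rmorph1 cp_const) -linearZ cp_evalC /= su2_charA.
Qed.

Lemma radius_pointP s : s \in [:: radius_relator] -> Utr_char s = 0.
Proof.
rewrite inE => /eqP ->; rewrite rmorphB !rmorphD !rmorphXn /= Utr_charA.
rewrite /Utr_char cp_evalX !cp_evalC /= !cp_evalC /= !su2_charE /su2_point /=.
rewrite expr0n /= !addr0 /radius_point /h_of mulf_eq0 mulf_eq0 pnatr_eq0 (negPf (neq0Ci K)) /=.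
by case: eqP => [->|_]; rewrite !(expr1n, expr0n) /= ?addr0 ?add0r subrr.
Qed.

Fact radius_proper : ~ two_sided_ideal [:: radius_relator] 1.
Proof. exact: (@proper_rmorph K (Utr h) K Utr_char) radius_pointP. Qed.

Definition radius_relators : relators (Utr h) := Relators radius_proper.

Definition qA : algType K := quot_alg radius_relators.

Definition qA_proj : Utr h -> qA := quot_proj radius_relators.

HB.instance Definition _ := GRing.LRMorphism.on qA_proj.

Definition qA_x : qA := qA_proj (Utr_x h).
Definition qA_y : qA := qA_proj (Utr_y h).
Definition qA_z : qA := qA_proj (Utr_z h).
Definition qA_t : qA := qA_proj (Utr_t h).
Definition qA_r : qA := qA_proj (Utr_r h).

Definition qA_char : qA -> K :=
  @quot_lift K (Utr h) radius_relators K Utr_char radius_pointP.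

HB.instance Definition _ := GRing.RMorphism.on qA_char.

(* The localization A[r_hbar^-1] at the central element r_hbar is              *)
(* A[X] / (r_hbar X - 1), with r_hbar^-1 the class of X.                       *)
Definition loc_relator : central_poly qA := cp_const qA_r * cp_var - 1.

Lemma radius_point_neq0 : radius_point != 0.
Proof. by rewrite /radius_point; case: ifP => [_|->] //; apply: oner_neq0. Qed.

Definition loc_char : central_poly qA -> K := cp_eval qA_char radius_point^-1.

HB.instance Definition _ := GRing.RMorphism.on loc_char.

Lemma loc_pointP s : s \in [:: loc_relator] -> loc_char s = 0.
Proof.
rewrite inE => /eqP ->; rewrite rmorphB rmorphM rmorph1 /= /loc_char cp_evalX.
rewrite cp_evalC /= /qA_char quot_liftE /= /Utr_char cp_evalX.
by rewrite mulfV ?subrr // radius_point_neq0.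
Qed.

Fact loc_proper : ~ two_sided_ideal [:: loc_relator] 1.
Proof. exact: (@proper_rmorph K (central_poly qA) K loc_char) loc_pointP. Qed.

Definition loc_relators : relators (central_poly qA) := Relators loc_proper.

Definition qAloc : algType K := quot_alg loc_relators.

Definition qA_loc : qA -> qAloc := quot_proj loc_relators \o cp_const.

HB.instance Definition _ := GRing.LRMorphism.on qA_loc.

Definition loc_x : qAloc := qA_loc qA_x.
Definition loc_y : qAloc := qA_loc qA_y.
Definition loc_z : qAloc := qA_loc qA_z.
Definition loc_t : qAloc := qA_loc qA_t.
Definition loc_r : qAloc := qA_loc qA_r.
Definition loc_rV : qAloc := quot_proj loc_relators cp_var.

Lemma loc_rVK : loc_r * loc_rV = 1.
Proof.
rewrite -[loc_r]/(quot_proj loc_relators (cp_const qA_r)) -rmorphM.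
rewrite -(rmorph1 (quot_proj loc_relators)); apply/quot_projP.
by apply: two_sided_gen; rewrite inE.
Qed.

Lemma loc_rV_central u : loc_rV * u = u * loc_rV.
Proof.
elim/quot_ind: u => u; rewrite -!rmorphM; congr quot_proj.
by rewrite cp_varE; apply: (esym (commr_polyX (u : {poly qA}))).
Qed.

Lemma loc_rKV : loc_rV * loc_r = 1.
Proof. by rewrite loc_rV_central loc_rVK. Qed.

Definition int_mx4 (s : seq (seq int)) : 'M[qAloc]_4 :=
  \matrix_(i, j) ((nth 0 (nth [::] s i) j)%:~R).

Definition mxA : 'M[qAloc]_4 := int_mx4
  [:: [::  0;  1;  0;  0];
      [:: -1;  0;  0;  0];
      [::  0;  0;  0; -1];
      [::  0;  0;  1;  0]].

Definition mxB : 'M[qAloc]_4 := int_mx4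
  [:: [::  0;  0;  1;  0];
      [::  0;  0;  0;  1];
      [:: -1;  0;  0;  0];
      [::  0; -1;  0;  0]].

Definition mxC : 'M[qAloc]_4 := int_mx4
  [:: [::  0;  0;  0;  1];
      [::  0;  0; -1;  0];
      [::  0;  1;  0;  0];
      [:: -1;  0;  0;  0]].

Definition mxM : 'M[qAloc]_4 := loc_x *: mxA + loc_y *: mxB + loc_z *: mxC.

(* Mat_4(A[r_hbar^-1]) is a K-algebra through K -> A[r_hbar^-1].               *)
Definition mx_scale : K -> 'M[qAloc]_4 -> 'M[qAloc]_4 := GRing.in_alg qAloc \; *:%R.

HB.instance Definition _ := GRing.Scale.Law.on mx_scale.
HB.instance Definition _ := GRing.Scale.SemiLaw.on mx_scale.

(* B is to be either U(su(2)_h) (x) K[t, r] or its quotient A. Matrix entries  *)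
(* do not commute: u *: N multiplies those of N by u on the left, which is     *)
(* harmless here as the entries of I, A, B, C are integers.                    *)
Definition theta_assignment (B : pzRingType) (x y z t r : B)
    (Theta : B -> 'M[qAloc]_4) : Prop :=
  [/\ Theta 1 = 1%:M /\ Theta t = (loc_t + ih%:A) *: 1%:M,
      Theta x = loc_x *: 1%:M + ih%:A *: mxA,
      Theta y = loc_y *: 1%:M + ih%:A *: mxB,
      Theta z = loc_z *: 1%:M + ih%:A *: mxC &
      Theta r = ((loc_r ^+ 2 + (hbar ^+ 2)%:A) * loc_rV) *: 1%:M
                + (ih%:A * loc_rV) *: mxM].

(* The coefficient of the identity matrix is the shifted derivative            *)
(* dt + (2/h) id.                                                              *)
Definition quantum_partials (Theta : qA -> 'M[qAloc]_4)
    (dt dx dy dz : qA -> qAloc) : Prop :=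
  forall a : qA,
    Theta a = ih%:A *: ((dt a + (2 / h) *: qA_loc a) *: 1%:M
                        + dx a *: mxA + dy a *: mxB + dz a *: mxC).

End QuantumAlgebra.

Arguments qA_proj {K hbar} _.
Arguments qA_loc {K hbar} _.

(* Main.v *)
(******************************************************************************)
(* The span of I, A, B, C over A[r^-1] is a ring of quaternions with          *)
(* noncommutative coefficients, in which a matrix is determined by its first  *)
(* row (a, b, c, d). Put s = 'i hbar, so that h = 2 s and hbar^2 = - s^2. The *)
(* images of x, y, z are (x, s, 0, 0), (y, 0, s, 0), (z, 0, 0, s), and that   *)
(* of r is (r - s^2 r^-1, s r^-1 x, s r^-1 y, s r^-1 z): the quaternion       *)
(* product gives the su(2) relations between them, and both Theta(r)^2 and    *)
(* Theta(x)^2 + Theta(y)^2 + Theta(z)^2 + hbar^2 are equal to                 *)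
(* (r^2 - 3 s^2, 2 s x, 2 s y, 2 s z). The partial derivatives are the        *)
(* entries of the first row up to the unit s, and 2 / h = s^-1, so those of r *)
(* are read off from the image of r.                                          *)
(******************************************************************************)

From HB Require Import structures.
Require Import Defs.
From mathcomp Require Import all_boot all_order all_algebra ring.
From mathcomp Require Import reals complex.
From mathcomp Require Import finmap.
From mathcomp.multinomials Require Import monalg.

Set Implicit Arguments.
Unset Strict Implicit.
Unset Printing Implicit Defensive.

Import GRing.Theory.
Local Open Scope ring_scope.

(** * Quaternions with noncommutative coefficients as 4 x 4 matrices *)

Section QuaternionMatrix.
Variable Q : nzRingType.

(** [quat_mx a b c d] is [a I + b A + c B + d C], and [quat_mxM] is the quaternion product with the
    order of the coefficients kept.

    By the universal property of U(su(2)_h)[t][r] ([Utr_lift]), the assignment extends as soon as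
    the images X, Y, Z of x, y, z satisfy the su(2) relations ([theta_xy], [theta_yz], [theta_zx]),
    the image of t is central, and the image of r commutes with X, Y, Z. The last point reduces to
    [M = x A + y B + z C], which commutes with X, Y, Z because h = 2s makes the commutators of the
    coefficients cancel those of A, B, C ([theta_xM], [theta_yM], [theta_zM]). The radius relator is
    killed by comparing two explicit quaternions ([theta_r2], [theta_radius]), so the map descends
    to the quotient. It is unique because it is fixed on scalars and generators.

    Every image lies in the span of I, A, B, C ([theta_quat]), hence partial derivatives exist; they
    are unique since the first row determines the quaternion and s is invertible. For r they are
    read off from [theta_r]. *)

Definition quat_mx (a b c d : Q) : 'M[Q]_4 :=
  \matrix_(i, j) nth 0 (nth [::]
    [:: [::   a;   b;   c;   d];
        [:: - b;   a; - d;   c];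
        [:: - c;   d;   a; - b];
        [:: - d; - c;   b;   a]] i) j.

Lemma quat_mx_inj a b c d a' b' c' d' :
  quat_mx a b c d = quat_mx a' b' c' d' -> [/\ a = a', b = b', c = c' & d = d'].
Proof.
move=> /matrixP E; split.
- by have:= E 0 0; rewrite !mxE.
- by have:= E 0 1; rewrite !mxE.
- by have:= E 0 2%:R; rewrite !mxE.
- by have:= E 0 3%:R; rewrite !mxE.
Qed.

Lemma eq_quat_mx a b c d a' b' c' d' :
  a = a' -> b = b' -> c = c' -> d = d' -> quat_mx a b c d = quat_mx a' b' c' d'.
Proof. by move=> -> -> -> ->. Qed.

Ltac each_entry :=
  apply/matrixP; case=> [[|[|[|[|?]]]] // ?]; case=> [[|[|[|[|?]]]] // ?]; rewrite !mxE /=.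

Lemma quat_mxC a : a%:M = quat_mx a 0 0 0.
Proof. by each_entry; rewrite ?oppr0. Qed.

Lemma quat_mxD a b c d a' b' c' d' :
  quat_mx a b c d + quat_mx a' b' c' d' = quat_mx (a + a') (b + b') (c + c') (d + d').
Proof. by each_entry; rewrite ?opprD. Qed.

Lemma quat_mxN a b c d : - quat_mx a b c d = quat_mx (- a) (- b) (- c) (- d).
Proof. by each_entry. Qed.

Lemma quat_mxZ u a b c d :
  u *: quat_mx a b c d = quat_mx (u * a) (u * b) (u * c) (u * d).
Proof. by each_entry; rewrite ?mulrN. Qed.

Lemma quat_mxM a b c d a' b' c' d' :
  quat_mx a b c d * quat_mx a' b' c' d' =
  quat_mx (a * a' - b * b' - c * c' - d * d') (a * b' + b * a' + c * d' - d * c')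
          (a * c' + c * a' + d * b' - b * d') (a * d' + d * a' + b * c' - c * b').
Proof.
each_entry; rewrite !big_ord_recl big_ord0 !mxE /= !(mulrN, mulNr) ?opprK addr0.
all: rewrite ?opprD ?opprK ?addrA.
(* Every permutation of four terms is a product of these transpositions.       *)
all: [> once ((idtac + rewrite [LHS](ACl (2*1*3*4)) + rewrite [LHS](ACl (3*2*1*4))
                     + rewrite [LHS](ACl (4*2*3*1)));
              (idtac + rewrite [LHS](ACl (1*3*2*4)) + rewrite [LHS](ACl (1*4*3*2)));
              (idtac + rewrite [LHS](ACl (1*2*4*3))); by []) ..].
Qed.

Lemma scalar_mx_central (u : Q) (N : 'M[Q]_4) :
  (forall v, u * v = v * u) -> u%:M * N = N * u%:M.
Proof.
move=> uC; apply/matrixP=> i j; rewrite -[in LHS]mulmxE -[in RHS]mulmxE.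
rewrite mul_scalar_mx !mxE (bigD1 j) //= !mxE eqxx mulr1n uC big1 ?addr0 // => k kj.
by rewrite !mxE (negPf kj) mulr0n mulr0.
Qed.

End QuaternionMatrix.

(** * The relations satisfied by the images of x, y, z, r *)

Section ThetaRelations.
Variables (K : comNzRingType) (Q : algType K) (s : K) (x y z r V : Q).
Hypotheses (rC : forall u, r * u = u * r) (VC : forall u, V * u = u * V).
Hypothesis rV : r * V = 1.
Hypotheses (xy : x * y - y * x = (2 * s) *: z) (yz : y * z - z * y = (2 * s) *: x)
           (zx : z * x - x * z = (2 * s) *: y).
Hypothesis radius : x ^+ 2 + y ^+ 2 + z ^+ 2 = r ^+ 2 + (s ^+ 2)%:A.

(** [V] stands for the inverse of [r]. With hbar^2 = - s^2, the scalar part (r^2 + hbar^2) / r of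
    the assigned image becomes r - s^2 V. *)
Definition theta_r := quat_mx (r - s ^+ 2 *: V) (s *: (V * x)) (s *: (V * y)) (s *: (V * z)).
Local Notation X := (quat_mx x s%:A 0 0).
Local Notation Y := (quat_mx y 0 s%:A 0).
Local Notation Z := (quat_mx z 0 0 s%:A).

(** The cross terms cancel because s is a scalar. The real part is the relation [xy], and s^2 (AB -
    BA) = 2 s^2 C supplies the C-part. *)
Lemma theta_xy : X * Y - Y * X = (2 * s)%:A%:M * Z.
Proof.
rewrite quat_mxC !quat_mxM quat_mxN quat_mxD; apply: eq_quat_mx;
  rewrite !(mulr0, mul0r, subr0, sub0r, add0r, addr0, oppr0, mulr_algl, mulr_algr) ?subrr //.
by rewrite opprK !scalerA -scalerDl; congr (_ *: _); ring.
Qed.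

Lemma theta_yz : Y * Z - Z * Y = (2 * s)%:A%:M * X.
Proof.
rewrite quat_mxC !quat_mxM quat_mxN quat_mxD; apply: eq_quat_mx;
  rewrite !(mulr0, mul0r, subr0, sub0r, add0r, addr0, oppr0, mulr_algl, mulr_algr) ?subrr //.
by rewrite opprK !scalerA -scalerDl; congr (_ *: _); ring.
Qed.

Lemma theta_zx : Z * X - X * Z = (2 * s)%:A%:M * Y.
Proof.
rewrite quat_mxC !quat_mxM quat_mxN quat_mxD; apply: eq_quat_mx;
  rewrite !(mulr0, mul0r, subr0, sub0r, add0r, addr0, oppr0, mulr_algl, mulr_algr) ?subrr //.
by rewrite opprK !scalerA -scalerDl; congr (_ *: _); ring.
Qed.

(* The matrix M of the paper.                                                  *)
Let M := quat_mx 0 x y z.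

Lemma theta_rE : theta_r = (r - s ^+ 2 *: V)%:M + (s *: V)%:M * M.
Proof.
rewrite !quat_mxC quat_mxM quat_mxD.
by apply: eq_quat_mx; rewrite !(mulr0, mul0r, subr0, addr0, add0r) ?scalerAl.
Qed.

Let aC u : (r - s ^+ 2 *: V) * u = u * (r - s ^+ 2 *: V).
Proof. by rewrite mulrBl mulrBr rC -scalerAl VC scalerAr. Qed.

(** [theta_r] is a central scalar matrix plus a central multiple of [M], so only [M] can obstruct
    commutation. *)
Lemma theta_rC (N : 'M[Q]_4) : M * N = N * M -> theta_r * N = N * theta_r.
Proof.
have VsC u : s *: V * u = u * (s *: V) by rewrite -scalerAl VC scalerAr.
move=> MN; rewrite theta_rE mulrDl mulrDr (scalar_mx_central _ aC).
by rewrite -mulrA MN mulrA (scalar_mx_central _ VsC) mulrA.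
Qed.

(** In the B- and C-parts the two products differ by a commutator of x with y or z and by a term
    [(2 * s)] times z or y coming from the products of A with B and C; these cancel. [theta_yM] and
    [theta_zM] are the cyclic analogues. *)
Lemma theta_xM : M * X = X * M.
Proof.
rewrite !quat_mxM; apply: eq_quat_mx;
  rewrite !(mulr0, mul0r, subr0, sub0r, add0r, addr0, mulr_algl, mulr_algr) //.
- rewrite -[x * y](subrK (y * x)) xy [_ + y * x]addrC -addrA -scalerBl.
  by congr (_ + _ *: _); ring.
- rewrite -[z * x](subrK (x * z)) zx [_ + x * z]addrC -addrA -scalerBl.
  by congr (_ + _ *: _); ring.
Qed.

Lemma theta_yM : M * Y = Y * M.
Proof.
rewrite !quat_mxM; apply: eq_quat_mx;
  rewrite !(mulr0, mul0r, subr0, sub0r, add0r, addr0, mulr_algl, mulr_algr) //.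
- rewrite -[x * y](subrK (y * x)) xy [_ + y * x]addrC -addrA -scalerBl.
  by congr (_ + _ *: _); ring.
- rewrite -[y * z](subrK (z * y)) yz [_ + z * y]addrC -addrA -scalerBl.
  by congr (_ + _ *: _); ring.
Qed.

Lemma theta_zM : M * Z = Z * M.
Proof.
rewrite !quat_mxM; apply: eq_quat_mx;
  rewrite !(mulr0, mul0r, subr0, sub0r, add0r, addr0, mulr_algl, mulr_algr) //.
- rewrite -[z * x](subrK (x * z)) zx [_ + x * z]addrC -addrA -scalerBl.
  by congr (_ + _ *: _); ring.
- rewrite -[y * z](subrK (z * y)) yz [_ + z * y]addrC -addrA -scalerBl.
  by congr (_ + _ *: _); ring.
Qed.

Let sVM u v : (s *: (V * u)) * (s *: (V * v)) = s ^+ 2 *: (V ^+ 2 * (u * v)).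
Proof.
rewrite -scalerAl -scalerAr scalerA -expr2; congr (_ *: _).
by rewrite expr2 -!mulrA [u * (V * v)]mulrA -VC !mulrA.
Qed.

Let aM u : (r - s ^+ 2 *: V) * (s *: (V * u)) = s *: u - s ^+ 3 *: (V ^+ 2 * u).
Proof.
rewrite -scalerAr mulrBl mulrA rV mul1r -scalerAl mulrA -expr2 scalerBr scalerA.
by rewrite -exprS.
Qed.

Let Ma u : (s *: (V * u)) * (r - s ^+ 2 *: V) = s *: u - s ^+ 3 *: (V ^+ 2 * u).
Proof. by rewrite -aC aM. Qed.

(** One imaginary component of [theta_r * theta_r], for a cyclic triple u, v, w: the cross terms
    give 2 s u - 2 s^3 V^2 u, and the commutator of v and w restores 2 s^3 V^2 u. *)
Let theta_r2_im u v w : v * w - w * v = (2 * s) *: u ->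
  (r - s ^+ 2 *: V) * (s *: (V * u)) + (s *: (V * u)) * (r - s ^+ 2 *: V) +
  (s *: (V * v)) * (s *: (V * w)) - (s *: (V * w)) * (s *: (V * v)) = (2 * s) *: u.
Proof.
move=> vw; rewrite aM Ma !sVM -addrA -scalerBr -mulrBr vw -scalerAr.
rewrite scalerA addrACA -scalerDl -opprD -scalerDl -addrA -scaleNr -scalerDl.
by rewrite [X in _ + X *: _](_ : _ = 0) ?scale0r ?addr0; [congr (_ *: _); ring | ring].
Qed.

Let Vr : V * r = 1. Proof. by rewrite -rC. Qed.

Lemma theta_r2 : theta_r * theta_r =
  quat_mx (r ^+ 2 - (3 * s ^+ 2)%:A) ((2 * s) *: x) ((2 * s) *: y) ((2 * s) *: z).
Proof.
rewrite quat_mxM; apply: eq_quat_mx.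
(* The radius relation turns s^2 V^2 (x^2 + y^2 + z^2) into s^2 + s^4 V^2. The s^4 V^2 cancels
   against (r - s^2 V)^2 = r^2 - 2 s^2 + s^4 V^2, leaving r^2 - 3 s^2. *)
- rewrite !sVM -!addrA -!opprD -!scalerDr -!mulrDr -!expr2 addrA radius.
  have V2r2 : V ^+ 2 * r ^+ 2 = 1 by rewrite !expr2 mulrA -[V * V * r]mulrA Vr mulr1.
  rewrite mulrDr V2r2 mulr_algr.
  rewrite [(r - _) ^+ 2]expr2 mulrBl !mulrBr -!scalerAr -!scalerAl rV Vr.
  rewrite -!expr2 scalerDr opprB opprD [- (_ *: 1) - _]addrC -addrA [in X in _ + X = _]addrACA.
  rewrite subrr add0r -addrA; congr (_ + _); rewrite -!opprD -!scalerDl.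
  by congr (- (_ *: _)); ring.
- exact: theta_r2_im yz.
- exact: theta_r2_im zx.
- exact: theta_r2_im xy.
Qed.

Lemma theta_radius :
  X * X + Y * Y + Z * Z + (- s ^+ 2)%:A%:M - theta_r * theta_r = 0.
Proof.
rewrite theta_r2 quat_mxC !quat_mxM quat_mxN !quat_mxD.
have -> : (0 : 'M[Q]_4) = quat_mx 0 0 0 0 by rewrite -quat_mxC raddf0.
apply: eq_quat_mx.
all: rewrite !(mulr0, mul0r, oppr0, subr0, sub0r, add0r, addr0, mulr_algl, mulr_algr).
all: try by rewrite -scalerDl -scalerBl; rewrite [X in X *: _](_ : _ = 0) ?scale0r //; ring.
apply/eqP; rewrite subr_eq0 scalerA -!expr2 [x ^+ 2 - _ + _]addrACA
  [_ + (z ^+ 2 - _)]addrACA radius -!addrA.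
apply/eqP; congr (_ + _); rewrite -!scaleNr -!scalerDl.
by congr (_ *: _); ring.
Qed.

End ThetaRelations.

(** * Universal properties of the free algebra and of central polynomials *)

Section Lifts.
Variables (K : comNzRingType) (T : nzRingType).

(** The target is only a ring, so linearity is recorded by a morphism [sc] with central image. This
    is what suits matrices over a K-algebra. *)
Lemma free_alg_lift (I : choiceType) (sc : {rmorphism K -> T}) (v : I -> T) :
    (forall k u, sc k * u = u * sc k) ->
  exists f : {rmorphism free_alg K I -> T},
    (forall k, f k%:A = sc k) /\ (forall i, f (free_gen K i) = v i).
Proof.
move=> scC; pose m (w : {fmonom I}) : T := \prod_(i <- w) v i.
have m_morph : mmorphism m.
  by split=> [m1 m2|]; rewrite /m ?fmM ?big_cat // fm1 big_nil.
pose mM := isMultiplicative.Build {fmonom I} T m m_morph.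
pose m' : {mmorphism {fmonom I} -> T} := HB.pack m mM.
pose g : free_alg K I -> T := mmap sc m'.
have gZ : zmod_morphism g by exact: mmap_is_additive.
have gM : monoid_morphism g.
  have [gM g1] : multiplicative (mmap sc m').
    by apply: commr_mmap_is_multiplicative => *; apply: scC.
  (* [free_mul] is a locked copy of the product for which [gM] is known. *)
  split=> // u w; rewrite -[u * w]/(free_mul u w) free_mulE.
  exact: gM.
pose gZi := GRing.isZmodMorphism.Build (free_alg K I) T g gZ.
pose gMi := GRing.isMonoidMorphism.Build (free_alg K I) T g gM.
pose f : {rmorphism free_alg K I -> T} := HB.pack g gZi gMi.
exists f; split=> [k|i].
  rewrite -[k%:A]/(free_scale k 1) free_scaleE /= /g mmapZ.
  by rewrite mmap1 mulr1.
rewrite /= /g /free_gen unlock mmapU /= rmorph1 mul1r /m fmU.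
by rewrite big_seq1.
Qed.

Lemma central_poly_lift (A : algType K) (f : {rmorphism A -> T}) (b : T) :
    (forall a, b * f a = f a * b) ->
  exists g : {rmorphism central_poly A -> T},
    (forall a, g (cp_const a) = f a) /\ g cp_var = b.
Proof.
move=> bC; pose cfb : commr_rmorph f b := bC.
pose g : {rmorphism central_poly A -> T} := GRing.RMorphism.clone _ _ (horner_morph cfb) _.
exists g; split=> [a|]; rewrite /= ?cp_constE ?cp_varE.
- exact: horner_morphC.
- exact: horner_morphX.
Qed.

End Lifts.

(** * Induction on generators *)

Section Generation.
Variable K : comNzRingType.

Lemma free_alg_ind (I : choiceType) (P : free_alg K I -> Prop) :
    (forall k, P k%:A) -> (forall u v, P u -> P v -> P (u + v)) ->
    (forall u v, P u -> P v -> P (u * v)) -> (forall i, P (free_gen K i)) ->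
  forall u, P u.
Proof.
move=> P_K PD PM PX u.
(* Words are built letter by letter; a general element is then a sum of constants times words. *)
have Pw (w : seq I) : P (<< FMonom w >> : {malg K[{fmonom I}]}).
  elim: w => [|i w IH].
    have := P_K 1; rewrite scale1r; congr P.
    by rewrite -fmoneE.
  have := PM _ _ (PX i) IH; congr P.
  rewrite -[LHS]/(free_mul _ _) free_mulE /free_gen unlock malgM_def fgmulUU mul1r.
  by congr (mkmalgU _ _); apply/eqP; rewrite fmP fmM fmU.
rewrite [u](monalgE u); elim: (enum_fset (msupp u)) => [|w ws IH].
  by rewrite big_nil; have := P_K 0; rewrite scale0r.
rewrite big_cons; apply: PD IH.
have := PM _ _ (P_K (mcoeff w u)) (Pw w); congr P.
rewrite mulr_algl -[LHS]/(free_scale _ _) free_scaleE fmK.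
by rewrite -mul_malgC malgM_def fgmulUU mulr1 mul1m.
Qed.

Lemma central_poly_ind (A : algType K) (P : central_poly A -> Prop) :
    (forall a, P (cp_const a)) -> P cp_var ->
    (forall u v, P u -> P v -> P (u + v)) ->
    (forall u v, P u -> P v -> P (u * v)) ->
  forall u, P u.
Proof.
move=> PC PX PD PM; apply: poly_ind => [|p c Pp].
  by rewrite -polyC0 -cp_constE.
by rewrite -cp_constE -cp_varE; apply: PD => //; apply: PM.
Qed.

End Generation.

(** * Transport of centrality through polynomial extensions and quotients *)

Section Centrality.
Variables (K : comNzRingType) (A : algType K).

Lemma cp_var_central (u : central_poly A) : cp_var * u = u * cp_var.
Proof. by rewrite cp_varE; apply: (esym (commr_polyX (u : {poly A}))). Qed.

Lemma cp_const_central (a : A) :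
  (forall b, a * b = b * a) -> forall u, cp_const a * u = u * cp_const a.
Proof.
move=> aC; apply: central_poly_ind => [b||u v IHu IHv|u v IHu IHv].
- by rewrite -!rmorphM aC.
- by rewrite cp_var_central.
- by rewrite mulrDr mulrDl IHu IHv.
- by rewrite mulrA IHu -mulrA IHv mulrA.
Qed.

Lemma quot_proj_central (S : relators A) (a : A) :
  (forall b, a * b = b * a) -> forall u, quot_proj S a * u = u * quot_proj S a.
Proof. by move=> aC; elim/quot_ind=> b; rewrite -!rmorphM aC. Qed.

End Centrality.

(** * Generators, relations and universal property of U(su(2)_h)[t][r] *)

Section UtrGeneration.
Variables (K : fieldType) (h : K).

Lemma Usu2_ind (P : Usu2 h -> Prop) :
    (forall k, P k%:A) -> (forall u v, P u -> P v -> P (u + v)) ->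
    (forall u v, P u -> P v -> P (u * v)) ->
    P (su2_x h) -> P (su2_y h) -> P (su2_z h) ->
  forall u, P u.
Proof.
move=> P_K PD PM Px Py Pz; elim/quot_ind; apply: free_alg_ind.
- by move=> k; rewrite linearZ rmorph1; apply: P_K.
- by move=> u v; rewrite rmorphD; apply: PD.
- by move=> u v; rewrite rmorphM; apply: PM.
- case=> [[|[|[|i]]] // lti3].
  + by rewrite (_ : Ordinal lti3 = 0) //; apply: val_inj.
  + by rewrite (_ : Ordinal lti3 = 1) //; apply: val_inj.
  + by rewrite (_ : Ordinal lti3 = 2%:R) //; apply: val_inj.
Qed.

Lemma Utr_ind (P : Utr h -> Prop) :
    (forall k, P k%:A) -> (forall u v, P u -> P v -> P (u + v)) ->
    (forall u v, P u -> P v -> P (u * v)) ->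
    P (Utr_x h) -> P (Utr_y h) -> P (Utr_z h) -> P (Utr_t h) -> P (Utr_r h) ->
  forall u, P u.
Proof.
move=> P_K PD PM Px Py Pz Pt Pr; apply: central_poly_ind => //.
apply: central_poly_ind => // [|u v|u v].
- apply: Usu2_ind => // [k|u v|u v].
  + by rewrite 2!linearZ 2!rmorph1; apply: P_K.
  + by rewrite !rmorphD; apply: PD.
  + by rewrite !rmorphM; apply: PM.
- by rewrite rmorphD; apply: PD.
- by rewrite rmorphM; apply: PM.
Qed.

Lemma su2_xy : su2_x h * su2_y h - su2_y h * su2_x h = h *: su2_z h.
Proof.
rewrite -!rmorphM -rmorphB -linearZ; apply/quot_projP/two_sided_gen.
by rewrite inE eqxx.
Qed.

Lemma su2_yz : su2_y h * su2_z h - su2_z h * su2_y h = h *: su2_x h.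
Proof.
rewrite -!rmorphM -rmorphB -linearZ; apply/quot_projP/two_sided_gen.
by rewrite !inE; apply/or3P/Or32/eqxx.
Qed.

Lemma su2_zx : su2_z h * su2_x h - su2_x h * su2_z h = h *: su2_y h.
Proof.
rewrite -!rmorphM -rmorphB -linearZ; apply/quot_projP/two_sided_gen.
by rewrite !inE; apply/or3P/Or33/eqxx.
Qed.

(** The free algebra is lifted, passed to the quotient, and extended by t and then by r. The image
    of r is assumed to commute only with X, Y, Z, since [theta_r] need not be central among all
    matrices. *)
Lemma Utr_lift (T : nzRingType) (sc : {rmorphism K -> T}) (X Y Z tt rr : T) :
    (forall k u, sc k * u = u * sc k) ->
    X * Y - Y * X = sc h * Z -> Y * Z - Z * Y = sc h * X ->
    Z * X - X * Z = sc h * Y ->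
    (forall u, tt * u = u * tt) ->
    rr * X = X * rr -> rr * Y = Y * rr -> rr * Z = Z * rr ->
  exists f : {rmorphism Utr h -> T}, (forall k, f k%:A = sc k) /\
    [/\ f (Utr_x h) = X, f (Utr_y h) = Y, f (Utr_z h) = Z,
        f (Utr_t h) = tt & f (Utr_r h) = rr].
Proof.
move=> scC XY YZ ZX ttC rX rY rZ.
pose v (i : 'I_3) := nth 0 [:: X; Y; Z] i.
have [f0 [f0k f0v]] := free_alg_lift v scC.
have f0Z k u : f0 (k *: u) = sc k * f0 u by rewrite -mulr_algl rmorphM f0k.
have f00 s : s \in relators_seq (su2_relators h) -> f0 s = 0.
  by rewrite !inE => /or3P[] /eqP ->;
    rewrite !rmorphB !rmorphM f0Z /= !f0v /v /= ?XY ?YZ ?ZX subrr.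
pose f1 : {rmorphism Usu2 h -> T} := GRing.RMorphism.clone _ _ (quot_lift f00) _.
have f1E a : f1 (quot_proj _ a) = f0 a by exact: quot_liftE.
have f1k k : f1 k%:A = sc k by rewrite -f0k -f1E linearZ rmorph1.
have [f1x f1y f1z] : [/\ f1 (su2_x h) = X, f1 (su2_y h) = Y & f1 (su2_z h) = Z].
  by split; rewrite f1E f0v.
have [f2 [f2C f2X]] := central_poly_lift (fun a => ttC (f1 a)).
(* Commutation with X, Y, Z spreads to the whole image of [f2] by induction on generators. *)
have rrC a : rr * f2 a = f2 a * rr.
  elim/central_poly_ind: a => [a||u w IHu IHw|u w IHu IHw].
  - rewrite f2C; elim/Usu2_ind: a => [k|u w IHu IHw|u w IHu IHw|||].
    + by rewrite f1k scC.
    + by rewrite rmorphD mulrDr mulrDl IHu IHw.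
    + by rewrite rmorphM mulrA IHu -mulrA IHw mulrA.
    + by rewrite f1x.
    + by rewrite f1y.
    + by rewrite f1z.
  - by rewrite f2X ttC.
  - by rewrite rmorphD mulrDr mulrDl IHu IHw.
  - by rewrite rmorphM mulrA IHu -mulrA IHw mulrA.
have [f3 [f3C f3X]] := central_poly_lift rrC.
exists f3; split=> [k|].
  by rewrite -(rmorph1 cp_const) -linearZ f3C -(rmorph1 cp_const) -linearZ f2C f1k.
by split; rewrite /Utr_x /Utr_y /Utr_z /Utr_emb ?f3C ?f2C.
Qed.

End UtrGeneration.

(** * Relations and central elements in the quantum algebra and its localization *)

Section QuantumAlgebraFacts.
Variables (K : numClosedFieldType) (hbar : K).
Local Notation h := (h_of hbar).
Local Notation s := ('i * hbar).

Lemma h_ofE : h = 2 * s.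
Proof. by rewrite mulrA. Qed.

Let emb u := qA_loc (qA_proj (Utr_emb u) : qA hbar).

Lemma loc_xy : loc_x hbar * loc_y hbar - loc_y hbar * loc_x hbar = (2 * s) *: loc_z hbar.
Proof.
rewrite -h_ofE; have := congr1 emb (su2_xy h).
by rewrite /emb /Utr_emb !rmorphB !rmorphM !linearZ.
Qed.

Lemma loc_yz : loc_y hbar * loc_z hbar - loc_z hbar * loc_y hbar = (2 * s) *: loc_x hbar.
Proof.
rewrite -h_ofE; have := congr1 emb (su2_yz h).
by rewrite /emb /Utr_emb !rmorphB !rmorphM !linearZ.
Qed.

Lemma loc_zx : loc_z hbar * loc_x hbar - loc_x hbar * loc_z hbar = (2 * s) *: loc_y hbar.
Proof.
rewrite -h_ofE; have := congr1 emb (su2_zx h).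
by rewrite /emb /Utr_emb !rmorphB !rmorphM !linearZ.
Qed.

Lemma qA_radius : @qA_proj K hbar (radius_relator hbar) = 0.
Proof.
rewrite -(rmorph0 qA_proj); apply/quot_projP; rewrite subr0.
by apply: two_sided_gen; rewrite inE.
Qed.

Lemma sqr_ih : hbar ^+ 2 = - s ^+ 2.
Proof. by rewrite exprMn Num.Theory.sqrCi mulN1r opprK. Qed.

Lemma loc_radius :
  loc_x hbar ^+ 2 + loc_y hbar ^+ 2 + loc_z hbar ^+ 2 = loc_r hbar ^+ 2 + (s ^+ 2)%:A.
Proof.
have /eqP := congr1 qA_loc qA_radius.
rewrite /radius_relator !rmorph0 !rmorphB !rmorphD !rmorphXn /= 2!linearZ !rmorph1 /=.
by rewrite sqr_ih scaleNr subr_eq0 subr_eq => /eqP.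
Qed.

Lemma qA_t_central u : qA_t hbar * u = u * qA_t hbar.
Proof.
apply: quot_proj_central => a; apply: cp_const_central => b.
exact: cp_var_central.
Qed.

Lemma qA_r_central u : qA_r hbar * u = u * qA_r hbar.
Proof. by apply: quot_proj_central => a; apply: cp_var_central. Qed.

Lemma loc_t_central u : loc_t hbar * u = u * loc_t hbar.
Proof.
by apply: quot_proj_central => a; apply: cp_const_central; apply: qA_t_central.
Qed.

Lemma loc_r_central u : loc_r hbar * u = u * loc_r hbar.
Proof.
by apply: quot_proj_central => a; apply: cp_const_central; apply: qA_r_central.
Qed.

End QuantumAlgebraFacts.

(** * Existence of the morphism before imposing the radius relation *)

Section ThetaMorphism.
Variables (K : numClosedFieldType) (hbar : K).
Local Notation h := (h_of hbar).
Local Notation s := ('i * hbar).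
Local Notation Q := (qAloc hbar).
Local Notation x := (loc_x hbar).
Local Notation y := (loc_y hbar).
Local Notation z := (loc_z hbar).
Local Notation t := (loc_t hbar).
Local Notation r := (loc_r hbar).
Local Notation V := (loc_rV hbar).

(** [mxA], [mxB], [mxC] are the instances of this pattern at the three unit vectors. *)
Lemma int_mx4E (b c d : int) :
  int_mx4 hbar [:: [:: 0; b; c; d]; [:: - b; 0; - d; c];
                   [:: - c; d; 0; - b]; [:: - d; - c; b; 0]]
  = quat_mx 0 b%:~R c%:~R d%:~R.
Proof.
apply/matrixP; case=> [[|[|[|[|?]]]] // ?]; case=> [[|[|[|[|?]]]] // ?];
  by rewrite !mxE [LHS]/= [RHS]/= ?oppr0 ?mulrNz.
Qed.

Lemma quat_mxE (a b c d : Q) :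
  a *: 1%:M + b *: mxA hbar + c *: mxB hbar + d *: mxC hbar = quat_mx a b c d.
Proof.
have EA : mxA hbar = quat_mx 0 1 0 0 by exact: (int_mx4E 1 0 0).
have EB : mxB hbar = quat_mx 0 0 1 0 by exact: (int_mx4E 0 1 0).
have EC : mxC hbar = quat_mx 0 0 0 1 by exact: (int_mx4E 0 0 1).
rewrite scalemx1 quat_mxC EA EB EC !quat_mxZ !quat_mxD.
by rewrite !(mulr0, mulr1, addr0, add0r).
Qed.


Lemma theta_assignmentE (B : pzRingType) (x' y' z' t' r' : B) (F : B -> 'M[Q]_4) :
  theta_assignment x' y' z' t' r' F <->
  [/\ F 1 = 1 /\ F t' = (t + s%:A)%:M, F x' = quat_mx x s%:A 0 0,
      F y' = quat_mx y 0 s%:A 0, F z' = quat_mx z 0 0 s%:A &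
      F r' = theta_r s x y z r V].
Proof.
have Ex (a b : Q) : a *: 1%:M + b *: mxA hbar = quat_mx a b 0 0.
  by rewrite -quat_mxE !scale0r !addr0.
have Ey (a b : Q) : a *: 1%:M + b *: mxB hbar = quat_mx a 0 b 0.
  by rewrite -quat_mxE !scale0r !addr0.
have Ez (a b : Q) : a *: 1%:M + b *: mxC hbar = quat_mx a 0 0 b.
  by rewrite -quat_mxE !scale0r !addr0.
have EM : mxM hbar = quat_mx 0 x y z by rewrite -quat_mxE scale0r add0r.
rewrite /theta_assignment Ex Ey Ez EM scalemx1.
(* The two forms agree because (r^2 + hbar^2) V = r - s^2 V. *)
suff -> : theta_r s x y z r V = ((r ^+ 2 + (hbar ^+ 2)%:A) * V) *: 1%:M
    + (s%:A * V) *: quat_mx 0 x y z by [].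
rewrite quat_mxC quat_mxZ quat_mxZ quat_mxD /theta_r sqr_ih.
rewrite !(mulr0, mulr1, add0r, addr0) -!mulrA !mulr_algl.
by rewrite mulrDl mulr_algl [r ^+ 2]expr2 -mulrA loc_rVK mulr1 scaleNr.
Qed.

(** Since k u = (k 1) u, a ring morphism with the right values on scalars is linear for
    [mx_scale]. *)
Lemma lrmorphism_of_scalars (A : algType K) (f : {rmorphism A -> 'M[Q]_4}) :
  (forall k, f k%:A = (k%:A)%:M) ->
  exists g : {lrmorphism A -> 'M[Q]_4 | @mx_scale K hbar}, g =1 f.
Proof.
move=> fk; have fZ : scalable_for (@mx_scale K hbar) f.
  by move=> k u; rewrite -mulr_algl rmorphM fk -mulmxE mul_scalar_mx.
pose fZi := GRing.isScalable.Build K A 'M[Q]_4 (@mx_scale K hbar) f fZ.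
pose g : {lrmorphism A -> 'M[Q]_4 | @mx_scale K hbar} :=
  HB.pack (GRing.RMorphism.sort f) (GRing.RMorphism.class f) fZi.
by exists g.
Qed.

Lemma Utr_rmorph_ext (T : nzRingType) (f g : {rmorphism Utr h -> T}) :
  (forall k, f k%:A = g k%:A) ->
  f (Utr_x h) = g (Utr_x h) -> f (Utr_y h) = g (Utr_y h) ->
  f (Utr_z h) = g (Utr_z h) -> f (Utr_t h) = g (Utr_t h) ->
  f (Utr_r h) = g (Utr_r h) -> f =1 g.
Proof.
move=> fk fx fy fz ft fr; apply: Utr_ind => // u v fu fv.
- by rewrite !rmorphD fu fv.
- by rewrite !rmorphM fu fv.
Qed.

Let sc : {rmorphism K -> 'M[Q]_4} :=
  GRing.RMorphism.clone _ _ (@scalar_mx Q 4 \o GRing.in_alg Q) _.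

Lemma theta_exists : exists Theta0 : {lrmorphism Utr h -> 'M[Q]_4 | @mx_scale K hbar},
  theta_assignment (Utr_x h) (Utr_y h) (Utr_z h) (Utr_t h) (Utr_r h) Theta0.
Proof.
have scE k : sc k = (k%:A)%:M by [].
have scC k u : sc k * u = u * sc k.
  by rewrite scE; apply: scalar_mx_central => v; rewrite mulr_algl mulr_algr.
have tsC v : (t + s%:A) * v = v * (t + s%:A).
  by rewrite mulrDl mulrDr loc_t_central mulr_algl mulr_algr.
have tC u := scalar_mx_central u tsC.
have rC N := theta_rC s (@loc_r_central K hbar) (@loc_rV_central K hbar) (N := N).
(* The quaternion relations are stated with 2 s; each [etrans] rewrites this constant as [h]. *)
have [f [fk [fx fy fz ft fr]]] := Utr_lift scC
  (etrans (theta_xy (loc_xy hbar)) (congr1 (fun k => sc k * _) (esym (h_ofE hbar))))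
  (etrans (theta_yz (loc_yz hbar)) (congr1 (fun k => sc k * _) (esym (h_ofE hbar))))
  (etrans (theta_zx (loc_zx hbar)) (congr1 (fun k => sc k * _) (esym (h_ofE hbar))))
  tC (rC _ _ _ _ (theta_xM (loc_xy hbar) (loc_zx hbar)))
  (rC _ _ _ _ (theta_yM (loc_xy hbar) (loc_yz hbar)))
  (rC _ _ _ _ (theta_zM (loc_yz hbar) (loc_zx hbar))).
have [g gE] := lrmorphism_of_scalars fk.
by exists g; apply/theta_assignmentE; rewrite !gE rmorph1.
Qed.

End ThetaMorphism.

(** * Descent to the quotient and the partial derivatives *)

Section QuantumPartials.
Variables (K : numClosedFieldType) (hbar : K).
Hypothesis hbar_neq0 : hbar != 0.
Local Notation h := (h_of hbar).
Local Notation s := ('i * hbar).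
Local Notation Q := (qAloc hbar).
Local Notation theta_type A := {lrmorphism A -> 'M[Q]_4 | @mx_scale K hbar}.
Local Notation assigned0 :=
  (theta_assignment (Utr_x h) (Utr_y h) (Utr_z h) (Utr_t h) (Utr_r h)).
Local Notation assigned := (theta_assignment (qA_x hbar) (qA_y hbar)
  (qA_z hbar) (qA_t hbar) (qA_r hbar)).

Lemma theta_scalar (A : algType K) (F : theta_type A) k : F k%:A = k%:A%:M.
Proof. by rewrite linearZ rmorph1; apply: scalemx1. Qed.

Lemma theta_ext (f g : {rmorphism Utr h -> 'M[Q]_4}) :
    (forall k, f k%:A = g k%:A) -> assigned0 f -> assigned0 g -> f =1 g.
Proof.
move=> fg /theta_assignmentE[[_ ft] fx fy fz fr] /theta_assignmentE[[_ gt] gx gy gz gr].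
by apply: Utr_rmorph_ext; rewrite ?(ft, fx, fy, fz, fr).
Qed.

Lemma theta_radius_relator (F : theta_type (Utr h)) :
  assigned0 F -> F (radius_relator hbar) = 0.
Proof.
move=> /theta_assignmentE[_ Fx Fy Fz Fr].
rewrite /radius_relator rmorphB !rmorphD !rmorphXn /= theta_scalar Fx Fy Fz Fr.
rewrite sqr_ih !expr2; apply: theta_radius.
- exact: loc_r_central.
- exact: loc_rV_central.
- exact: loc_rVK.
- exact: loc_xy.
- exact: loc_yz.
- exact: loc_zx.
- exact: loc_radius.
Qed.

Lemma theta_descends (F0 : theta_type (Utr h)) : F0 (radius_relator hbar) = 0 ->
  exists F : theta_type (qA hbar), forall u, F (qA_proj u) = F0 u.
Proof.
move=> F0rad.
have F00 a : a \in relators_seq (radius_relators hbar) -> F0 a = 0.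
  by rewrite inE => /eqP ->.
pose f : {rmorphism qA hbar -> 'M[Q]_4} := GRing.RMorphism.clone _ _ (quot_lift F00) _.
have fE a : f (qA_proj a) = F0 a by exact: quot_liftE.
have [|F FE] := @lrmorphism_of_scalars K hbar (qA hbar) f.
  by move=> k; rewrite -(rmorph1 qA_proj) -linearZ fE theta_scalar.
by exists F => u; rewrite FE fE.
Qed.

(** The quaternion matrices contain the images of scalars and generators and are closed under sum
    and product. Without this, partial derivatives could not be read off. *)
Lemma theta_quat (F : theta_type (qA hbar)) a : assigned F ->
  exists b c d e, F a = quat_mx b c d e.
Proof.
move=> /theta_assignmentE[[_ Ft] Fx Fy Fz Fr].
elim/quot_ind: a; apply: Utr_ind => [k|u v|u v|||||].
- by rewrite linearZ rmorph1 theta_scalar quat_mxC; exists k%:A, 0, 0, 0.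
- move=> [b [c [d [e uE]]]] [b' [c' [d' [e' vE]]]].
  by rewrite 2!rmorphD /= uE vE quat_mxD; do 4!eexists.
- move=> [b [c [d [e uE]]]] [b' [c' [d' [e' vE]]]].
  by rewrite 2!rmorphM /= uE vE quat_mxM; do 4!eexists.
- by rewrite Fx; do 4!eexists.
- by rewrite Fy; do 4!eexists.
- by rewrite Fz; do 4!eexists.
- by rewrite Ft quat_mxC; do 4!eexists.
- by rewrite Fr; do 4!eexists.
Qed.

(** As 2 / h = s^-1, the defining equation is an equality of quaternions, to be compared on first
    rows. *)
Lemma quantum_partialsE (F : qA hbar -> 'M[Q]_4) dt dx dy dz :
  quantum_partials F dt dx dy dz <->
  forall a, F a = quat_mx (s *: (dt a + s^-1 *: qA_loc a))
                          (s *: dx a) (s *: dy a) (s *: dz a).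
Proof.
have -> : s^-1 = 2 / h.
  by rewrite h_ofE [(2 * _)^-1]invfM mulrA mulfV ?mul1r // Num.Theory.pnatr_eq0.
by split=> E a; rewrite E quat_mxE quat_mxZ !mulr_algl.
Qed.

Lemma ih_neq0 : s != 0.
Proof. by rewrite mulf_neq0 // Num.Theory.neq0Ci. Qed.

Lemma quantum_partials_exist (F : theta_type (qA hbar)) : assigned F ->
  exists dt dx dy dz, quantum_partials F dt dx dy dz.
Proof.
(* The witnesses are the first-row entries divided by s; the first also has the shift (2 / h) a
   subtracted. *)
move=> FA; exists (fun a => s^-1 *: F a 0 0 - s^-1 *: qA_loc a),
  (fun a => s^-1 *: F a 0 1), (fun a => s^-1 *: F a 0 2%:R), (fun a => s^-1 *: F a 0 3%:R).
apply/quantum_partialsE => a; have [b [c [d [e ->]]]] := theta_quat a FA.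
rewrite subrK !scalerA !mulfV ?ih_neq0 // !scale1r.
by rewrite !mxE.
Qed.

Lemma quantum_partials_uniq (F : qA hbar -> 'M[Q]_4) dt dx dy dz dt' dx' dy' dz' :
  quantum_partials F dt dx dy dz -> quantum_partials F dt' dx' dy' dz' ->
  [/\ dt' =1 dt, dx' =1 dx, dy' =1 dy & dz' =1 dz].
Proof.
move=> /quantum_partialsE E /quantum_partialsE E'.
have sI := scalerI ih_neq0.
by split=> a; have := E' a; rewrite E => /quat_mx_inj[/sI/addIr ? /sI ? /sI ? /sI ?].
Qed.

Lemma quantum_partials_radius (F : theta_type (qA hbar)) dt dx dy dz :
  assigned F -> quantum_partials F dt dx dy dz ->
  [/\ dt (qA_r hbar) = - (s *: loc_rV hbar),
      dx (qA_r hbar) = loc_x hbar * loc_rV hbar,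
      dy (qA_r hbar) = loc_y hbar * loc_rV hbar &
      dz (qA_r hbar) = loc_z hbar * loc_rV hbar].
Proof.
move=> /theta_assignmentE[_ _ _ _ Fr] /quantum_partialsE/(_ (qA_r hbar)).
rewrite Fr => /quat_mx_inj[Et Ex Ey Ez].
have sI := scalerI ih_neq0.
rewrite -!loc_rV_central; split; apply: sI => //.
(* The shift contributes s (s^-1 r) = r, which cancels the r of r - s^2 V and leaves s (dt r) = -
   s^2 V. *)
move: Et; rewrite scalerDr scalerA mulfV ?ih_neq0 // scale1r addrC => /addIr.
by rewrite scalerN scalerA -expr2.
Qed.

End QuantumPartials.

Theorem mainTheorem3 (R : realType) (hbar : R[i]) (hbar_neq0 : hbar != 0) :
  exists Theta0 : {lrmorphism Utr (h_of hbar) -> 'M[qAloc hbar]_4 | @mx_scale _ hbar},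
    let assigned0 := theta_assignment (Utr_x (h_of hbar)) (Utr_y (h_of hbar))
      (Utr_z (h_of hbar)) (Utr_t (h_of hbar)) (Utr_r (h_of hbar)) in
    [/\ assigned0 Theta0,
        forall Theta0' : {lrmorphism Utr (h_of hbar) -> 'M[qAloc hbar]_4
                            | @mx_scale _ hbar},
          assigned0 Theta0' -> Theta0' =1 Theta0,
        Theta0 (radius_relator hbar) = 0 &
    exists Theta : {lrmorphism qA hbar -> 'M[qAloc hbar]_4 | @mx_scale _ hbar},
      let assigned := theta_assignment (qA_x hbar) (qA_y hbar) (qA_z hbar)
        (qA_t hbar) (qA_r hbar) in
      [/\ forall u : Utr (h_of hbar), Theta (qA_proj u) = Theta0 u,
          assigned Theta,
          forall Theta' : {lrmorphism qA hbar -> 'M[qAloc hbar]_4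
                             | @mx_scale _ hbar},
            assigned Theta' -> Theta' =1 Theta &
      exists dt dx dy dz : qA hbar -> qAloc hbar,
        [/\ quantum_partials Theta dt dx dy dz,
            forall dt' dx' dy' dz' : qA hbar -> qAloc hbar,
              quantum_partials Theta dt' dx' dy' dz' ->
              [/\ dt' =1 dt, dx' =1 dx, dy' =1 dy & dz' =1 dz] &
            [/\ dt (qA_r hbar) = - (('i * hbar) *: loc_rV hbar),
                dx (qA_r hbar) = loc_x hbar * loc_rV hbar,
                dy (qA_r hbar) = loc_y hbar * loc_rV hbar &
                dz (qA_r hbar) = loc_z hbar * loc_rV hbar]]]].
Proof.
have [Theta0 A0] := theta_exists hbar; exists Theta0 => /=.
have rad0 := theta_radius_relator A0.
split=> // [Theta0' A0'|].
  by apply: (theta_ext _ A0' A0) => k; rewrite /= !theta_scalar.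
have [Theta ThetaE] := theta_descends rad0.
have A : theta_assignment (qA_x hbar) (qA_y hbar) (qA_z hbar)
    (qA_t hbar) (qA_r hbar) Theta.
  move: A0 => /theta_assignmentE[[_ ft] fx fy fz fr].
  by apply/theta_assignmentE; rewrite !ThetaE rmorph1.
exists Theta; split=> // [Theta' A'|].
  (* Uniqueness on the quotient follows from uniqueness before it, by composing with the
     projection. *)
  elim/quot_ind => u; rewrite -[RHS]/(Theta (qA_proj u)) ThetaE.
  apply: (@theta_ext _ hbar (Theta' \o qA_proj) Theta0 _ _ A0 u) => [k|].
    by rewrite /= linearZ rmorph1 !theta_scalar.
  move: A' => /theta_assignmentE[[_ ft] fx fy fz fr].
  by apply/theta_assignmentE; rewrite /= !rmorph1.
have [dt [dx [dy [dz d]]]] := quantum_partials_exist hbar_neq0 A.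
exists dt, dx, dy, dz; split=> // [dt' dx' dy' dz'|].
  exact: quantum_partials_uniq.
by have [] := quantum_partials_radius hbar_neq0 A d.
Qed.
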